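(* For every semigroup $S$ with zero $0_S$, any non-zero cardinal $\lambda$ and any positive integer $n\leqslant\lambda$ the following statements hold: (i) $\overline{\mathscr{I}_\lambda^n}(S)$ is regular if and only if $S$ is regular; (ii) $\overline{\mathscr{I}_\lambda^n}(S)$ is orthodox if and only if $S$ is orthodox; (iii) $\overline{\mathscr{I}_\lambda^n}(S)$ is inverse if and only if $S$ is inverse.
   Context: A semigroup $T$ is regular if for every $a\in T$ there is $b\in T$ with $a=aba$; orthodox if it is regular and its set of idempotents is a subsemigroup; inverse if for every $a\in T$ there is a unique $a^{-1}\in T$ with $aa^{-1}a=a$ and $a^{-1}aa^{-1}=a^{-1}$. $\mathscr{I}_\lambda^n$ is the semigroup of all partial injective maps $\lambda\rightharpoonup\lambda$ of rank (cardinality of the range) at most $n$, with composition $x(\alpha\beta)=(x\alpha)\beta$. The semigroup $\mathscr{I}_\lambda^n(S)$ consists of all maps $\alpha_S\colon \mathrm{Gr}(\alpha)\to S$, where $\alpha\in\mathscr{I}_\lambda^n$ and $\mathrm{Gr}(\alpha)\subset\lambda\times\lambda$ is the graph of $\alpha$; the element with empty graph is denoted $0$. The product $\alpha_S\cdot\beta_S$ has as underlying partial map the composition $\alpha\beta$, and if $(a,b)\in\mathrm{Gr}(\alpha)$ is sent to $s$ by $\alpha_S$ and $(b,d)\in\mathrm{Gr}(\beta)$ is sent to $t$ by $\beta_S$, then $\alpha_S\cdot\beta_S$ sends $(a,d)$ to $st$; in particular the product is $0$ if $\alpha\beta$ is empty. Let $\mathcal{J}_0\subset\mathscr{I}_\lambda^n(S)$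 be the ideal consisting of $0$ and all elements $\alpha_S$ all of whose values equal $0_S$. Define $\alpha_S\equiv_0\beta_S$ iff at least one of the following holds: (1) $\alpha_S=\beta_S$; (2) $\alpha_S,\beta_S\in\mathcal{J}_0$; (3) $\alpha_S,\beta_S\notin\mathcal{J}_0$ and, for every $(x,y)\in\lambda\times\lambda$, each of the conditions ''$(x,y)\alpha_S$ is defined and $\neq 0_S$'' and ''$(x,y)\beta_S$ is defined and $\neq 0_S$'' implies that $(x,y)\alpha_S=(x,y)\beta_S$ (both being defined). The relation $\equiv_0$ is a congruence on $\mathscr{I}_\lambda^n(S)$ and $\overline{\mathscr{I}_\lambda^n}(S)=\mathscr{I}_\lambda^n(S)/{\equiv_0}$. *)

(* Defs.v *)
From HB Require Import structures.
From mathcomp Require Import all_boot.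
From mathcomp Require Import boolp classical_sets functions cardinality.

Set Implicit Arguments.
Unset Strict Implicit.
Unset Printing Implicit Defensive.

Local Open Scope classical_set_scope.
Local Open Scope card_scope.
Local Open Scope group_scope.
Local Open Scope quotient_scope.

HB.mixin Record Semigroup_hasZero S of Semigroup S := {
  szero : S;
  smul0r : left_zero szero (@mul S);
  smulr0 : right_zero szero (@mul S)
}.

#[short(type="semigroup0Type")]
HB.structure Definition Semigroup0 := {S of Semigroup_hasZero S & Semigroup S}.

Definition idempotents (T : semigroupType) : set T := [set e | e * e = e].

Definition regular_semigroup (T : semigroupType) : Prop :=
  forall a : T, exists b : T, a = a * b * a.

Definition orthodox_semigroup (T : semigroupType) : Prop :=
  regular_semigroup T /\
  forall e f : T, idempotents e -> idempotents f -> idempotents (e * f).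

Definition inverse_semigroup (T : semigroupType) : Prop :=
  forall a : T, exists! b : T, a * b * a = a /\ b * a * b = b.

(* The semigroup of partial injective maps of rank at most n; a cardinal is
   represented by a type L of that cardinality. *)

Definition prange (L : Type) (f : L -> option L) : set L :=
  [set y | exists x, f x = Some y].

Record pinj (L : Type) (n : nat) := PInj {
  pfun :> L -> option L;
  pfun_inj : forall x1 x2 y, pfun x1 = Some y -> pfun x2 = Some y -> x1 = x2;
  pfun_rank : prange pfun #<= `I_n
}.

Section PInj.
Variables (L : Type) (n : nat).
Implicit Types f g h : pinj L n.

Lemma pinj_ext f g : pfun f =1 pfun g -> f = g.
Proof.
case: f g => [f fi fr] [g gi gr] /= /funext efg; subst g.
by rewrite (Prop_irrelevance fi gi) (Prop_irrelevance fr gr).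
Qed.

(* maps act on the right: f is applied first *)
Definition pcomp_fun f g : L -> option L := fun x => obind g (f x).

Lemma pcomp_funP f g x z :
  pcomp_fun f g x = Some z <-> exists y, f x = Some y /\ g y = Some z.
Proof.
rewrite /pcomp_fun; split; last by case=> y [-> /= ->].
by case: (f x) => //= y gy; exists y.
Qed.

Lemma pcomp_inj f g x1 x2 z :
  pcomp_fun f g x1 = Some z -> pcomp_fun f g x2 = Some z -> x1 = x2.
Proof.
move=> /pcomp_funP[y1 [f1 g1]] /pcomp_funP[y2 [f2 g2]].
by have ey := pfun_inj g1 g2; subst y2; exact: pfun_inj f1 f2.
Qed.

Lemma pcomp_rank f g : prange (pcomp_fun f g) #<= `I_n.
Proof.
apply: card_le_trans (pfun_rank g); apply: subset_card_le => z [x].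
by move=> /pcomp_funP[y [_ gy]]; exists y.
Qed.

Definition pinj_mul f g : pinj L n :=
  PInj (@pcomp_inj f g) (@pcomp_rank f g).

Lemma pinj_mulA : associative pinj_mul.
Proof.
by move=> f g h; apply: pinj_ext => x; rewrite /= /pcomp_fun /= /pcomp_fun; case: (f x).
Qed.

HB.instance Definition _ := gen_eqMixin (pinj L n).
HB.instance Definition _ := gen_choiceMixin (pinj L n).
HB.instance Definition _ := isSemigroup.Build (pinj L n) pinj_mulA.

Definition graph f : set (L * L) := [set p | f p.1 = Some p.2].

End PInj.

(* the maps Gr(under) -> S, for under a partial injective map of rank <= n *)
Record spinj (L : Type) (n : nat) (S : Type) := SPInj {
  under : pinj L n;
  sval_of : graph under -> S
}.

Section SPInj.
Variables (L : Type) (n : nat) (S : semigroup0Type).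
Implicit Types a b c : spinj L n S.

(* "(x, y)a is defined and equal to s" *)
Definition value a (x y : L) (s : S) : Prop :=
  exists p : graph (under a), val p = (x, y) /\ sval_of p = s.

Lemma value_fun a x y s t : value a x y s -> value a x y t -> s = t.
Proof.
by case=> p [ep <-] [q [eq <-]]; have -> : p = q by apply: val_inj; rewrite ep eq.
Qed.

Lemma value_under a x y s : value a x y s -> under a x = Some y.
Proof. by case=> -[p pa] /= [ep _]; move: pa; rewrite inE ep. Qed.

Lemma under_value a x y : under a x = Some y -> exists s, value a x y s.
Proof.
move=> xy; have xyP : (x, y) \in graph (under a) by rewrite inE.
by exists (sval_of (SigSub xyP)), (SigSub xyP).
Qed.

Lemma spinj_ext a b :
  (forall x y s, value a x y s <-> value b x y s) -> a = b.
Proof.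
move=> ab; have eu : under a = under b.
  apply: pinj_ext => x.
  case ax: (under a x) => [y|].
    by have [s /ab/value_under ->] := under_value ax.
  case bx: (under b x) => [y|//].
  by have [s /ab/value_under] := under_value bx; rewrite ax.
case: a b ab eu => [f u] [g v] ab /= eu; subst g; congr SPInj.
apply: funext => p.
have /ab[q [eq <-]] : value (SPInj u) (val p).1 (val p).2 (u p).
  by exists p; split=> //; case: (val p).
by have -> : p = q by apply: val_inj; rewrite eq; case: (val p).
Qed.

Section Product.
Variables a b : spinj L n S.
Implicit Types p : graph (under a * under b).

Lemma mid_exists p :
  exists y, under a (val p).1 = Some y /\ under b y = Some (val p).2.
Proof. by apply/pcomp_funP; have := valP p; rewrite inE. Qed.

(* the unique y with (x, y) in Gr(a) and (y, z) in Gr(b), where p = (x, z) *)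
Definition mid p : L := sval (cid (mid_exists p)).

Lemma mid_left p : ((val p).1, mid p) \in graph (under a).
Proof. by rewrite inE /mid; case: cid => y []. Qed.

Lemma mid_right p : (mid p, (val p).2) \in graph (under b).
Proof. by rewrite inE /mid; case: cid => y []. Qed.

Definition spinj_mul : spinj L n S :=
  @SPInj L n S (under a * under b)
    (fun p => sval_of (SigSub (mid_left p)) * sval_of (SigSub (mid_right p))).

Lemma value_mul x z r : value spinj_mul x z r <->
  exists y s t, [/\ value a x y s, value b y z t & r = s * t].
Proof.
split.
  case=> p [ep /= <-]; exists (mid p).
  exists (sval_of (SigSub (mid_left p))), (sval_of (SigSub (mid_right p))).
  split=> //; first by exists (SigSub (mid_left p)); split=> //=; rewrite ep.
  by exists (SigSub (mid_right p)); split=> //=; rewrite ep.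
case=> y [s [t [av bv ->]]].
have xzP : (x, z) \in graph (under a * under b).
  rewrite inE; apply/pcomp_funP; exists y.
  by split; [exact: value_under av | exact: value_under bv].
exists (SigSub xzP); split=> //=.
have [ay bz] := (mid_left (SigSub xzP), mid_right (SigSub xzP)).
have ey : mid (SigSub xzP) = y.
  by move: ay; rewrite inE /graph /= (value_under av) => -[].
congr (_ * _).
  by apply: value_fun av; exists (SigSub (mid_left (SigSub xzP))); split=> //=; rewrite ey.
by apply: value_fun bv; exists (SigSub (mid_right (SigSub xzP))); split=> //=; rewrite ey.
Qed.

End Product.

Lemma spinj_mulA : associative spinj_mul.
Proof.
move=> a b c; apply: spinj_ext => x z r; split.
  case/value_mul=> y [s [t [av /value_mul[w [t1 [t2 [bv cv ->]]]] ->]]].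
  apply/value_mul; exists w, (s * t1), t2; rewrite mulgA; split=> //.
  by apply/value_mul; exists y, s, t1.
case/value_mul=> w [s [t [/value_mul[y [s1 [s2 [av bv ->]]]] cv ->]]].
apply/value_mul; exists y, s1, (s2 * t); rewrite mulgA; split=> //.
by apply/value_mul; exists w, s2, t.
Qed.

HB.instance Definition _ := gen_eqMixin (spinj L n S).
HB.instance Definition _ := gen_choiceMixin (spinj L n S).
HB.instance Definition _ := isSemigroup.Build (spinj L n S) spinj_mulA.

(* The element with empty graph satisfies the condition vacuously. *)
Definition J0 : set (spinj L n S) :=
  [set a | forall p : graph (under a), sval_of p = szero].

Definition defined_nonzero a x y : Prop :=
  exists s, value a x y s /\ s <> szero.

Definition same_value a b x y : Prop :=
  exists s, value a x y s /\ value b x y s.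

Definition equiv0 a b : Prop :=
  [\/ a = b,
      J0 a /\ J0 b
    | [/\ ~ J0 a, ~ J0 b &
        forall x y, (defined_nonzero a x y -> same_value a b x y) /\
                    (defined_nonzero b x y -> same_value a b x y)]].

Lemma J0P a : J0 a <-> forall x y, ~ defined_nonzero a x y.
Proof.
split=> [Ja x y [s [[p [_ <-]]]]|nz p]; first by rewrite Ja.
apply: contrapT => pn0; apply: (nz (val p).1 (val p).2).
by exists (sval_of p); split=> //; exists p; split=> //; case: (val p).
Qed.

Lemma equiv0P a b : equiv0 a b <->
  forall x y s, s <> szero -> (value a x y s <-> value b x y s).
Proof.
split.
  case=> [-> //|[/J0P Ja /J0P Jb] x y s s0|[_ _ ab] x y s s0].
    by split=> v; [case: (Ja x y)|case: (Jb x y)]; exists s.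
  have [abl abr] := ab x y.
  split=> v; [case: abl; first by exists s|case: abr; first by exists s].
    by move=> t [/(value_fun v) ->].
  by move=> t [tv /(value_fun v) ->].
move=> ab.
have nzE x y : defined_nonzero a x y <-> defined_nonzero b x y.
  by split=> -[s [v s0]]; exists s; split=> //; apply/ab.
have JE : J0 a <-> J0 b.
  by split=> /J0P J; apply/J0P => x y /nzE; exact: J.
have [Ja|Ja] := pselect (J0 a); first by apply: Or32; split=> //; apply/JE.
apply: Or33; split=> // [/JE //|x y].
by split=> -[s [v s0]]; exists s; split=> //; apply/ab.
Qed.

Definition equiv0b : rel (spinj L n S) := fun a b => `[< equiv0 a b >].

Lemma equiv0b_refl : reflexive equiv0b.
Proof. by move=> a; apply/asboolP; apply/equiv0P. Qed.

Lemma equiv0b_sym : symmetric equiv0b.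
Proof.
move=> a b; apply/asboolP/asboolP=> /equiv0P ab; apply/equiv0P=> x y s s0;
by rewrite ab.
Qed.

Lemma equiv0b_trans : transitive equiv0b.
Proof.
move=> b a c /asboolP/equiv0P ab /asboolP/equiv0P bc.
by apply/asboolP/equiv0P => x y s s0; rewrite ab // bc.
Qed.

Canonical equiv0_rel : equiv_rel (spinj L n S) :=
  EquivRel equiv0b equiv0b_refl equiv0b_sym equiv0b_trans.

Lemma equiv0_mul a a' b b' :
  equiv0 a a' -> equiv0 b b' -> equiv0 (a * b) (a' * b').
Proof.
move=> /equiv0P aa' /equiv0P bb'; apply/equiv0P => x z r r0.
split=> /value_mul[y [s [t [av bv er]]]]; apply/value_mul; exists y, s, t;
  (have s0 : s <> szero by move=> s0; apply: r0; rewrite er s0 smul0r);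
  (have t0 : t <> szero by move=> t0; apply: r0; rewrite er t0 smulr0);
  by split=> //; [apply/aa'|apply/bb'].
Qed.

(* spinj L n S modulo equiv0 *)
Definition spinj_quot : Type := {eq_quot equiv0b}.

HB.instance Definition _ := Choice.on spinj_quot.
HB.instance Definition _ := EqQuotient.on spinj_quot.

Definition quot_mul : spinj_quot -> spinj_quot -> spinj_quot :=
  lift_op2 spinj_quot (@mul (spinj L n S)).

Lemma pi_quot_mul : {morph \pi_spinj_quot : a b / a * b >-> quot_mul a b}.
Proof.
move=> a b; rewrite /quot_mul; unlock.
apply/(@eqmodP _ equiv0_rel)/asboolP.
by apply: equiv0_mul; apply/asboolP/(@eqmodP _ equiv0_rel); rewrite reprK.
Qed.

Canonical pi_quot_mul_morph := PiMorph2 pi_quot_mul.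

Lemma quot_mulA : associative quot_mul.
Proof.
by elim/quotW=> a; elim/quotW=> b; elim/quotW=> c; rewrite !piE mulgA.
Qed.

HB.instance Definition _ := isSemigroup.Build spinj_quot quot_mulA.

Lemma pi_mulg : {morph \pi_spinj_quot : a b / a * b >-> a * b}.
Proof. exact: pi_quot_mul. Qed.

Lemma pi_eqP a b : \pi_spinj_quot a = \pi_spinj_quot b <-> equiv0 a b.
Proof.
by split=> [/(@eqmodP _ equiv0_rel)/asboolP|e]//; apply/(@eqmodP _ equiv0_rel)/asboolP.
Qed.

End SPInj.

(* Main.v *)
Require Import Defs.
From mathcomp Require Import all_boot.
From mathcomp Require Import boolp classical_sets functions cardinality.

(** An element of the quotient is nothing but an [L * L] matrix over [S] with
    at most one nonzero entry in each row and each column, and at most [n]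
    nonzero entries in all: the congruence forgets exactly the entries that are
    defined and zero.  Since rows and columns have at most one nonzero entry,
    the product is the matrix product, whose sums have at most one nonzero term
    ([entry_mul_row], [entry_mul_col], [entry_mul_row0]).

    Hence the three properties can be read off the entries.  The equation
    [a * b * a = a] holds if and only if the entries [s] of [a] at [(x, y)] and
    [t] of [b] at [(y, x)] always satisfy [s * t * s = s] ([sandwich_entry]),
    and [e] is idempotent if and only if it is diagonal with idempotent entries
    ([idempotent_entry]).  From [S] to the quotient, an element of [S] solving
    the problem for each entry is placed at the transposed position
    ([transpose_exists]); from the quotient to [S], elements of [S] are seen as
    matrices whose only entry sits at a fixed diagonal position
    ([corner_exists]). *)

Local Open Scope classical_set_scope.
Local Open Scope card_scope.

(** * Two constructions of partial injections *)

Section PartialInjections.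
Context {L : Type} {n : nat}.

Lemma pinj_transpose (f : pinj L n) :
  exists g : pinj L n, forall x y, g y = Some x <-> f x = Some y.
Proof.
pose g y := if pselect (exists x, f x = Some y) is left h then Some (sval (cid h))
            else None.
have gP x y : g y = Some x <-> f x = Some y.
  rewrite /g; case: pselect => [h|nh]; last by split=> // fx; case: nh; exists x.
  case: cid => x' /= fx'; split=> [[<-]//|fx].
  by rewrite (pfun_inj fx fx').
have g_inj y1 y2 x : g y1 = Some x -> g y2 = Some x -> y1 = y2.
  by move=> /gP + /gP => -> [].
have g_rank : prange g #<= `I_n.
  apply: card_le_trans (pfun_rank f).
  (* g maps the range of f onto Some @` (range of g) *)
  apply: card_le_trans (card_image_le g _).
  have Some_inj : {in prange g &, injective Some} by move=> ? ? _ _ [].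
  rewrite -(card_le_eql (inj_card_eq Some_inj)).
  apply: subset_card_le => _ [x [y gy] <-]; exists y => //.
  by exists x; apply/gP.
by exists (PInj g_inj g_rank).
Qed.

Lemma pinj_single (x0 : L) : (0 < n)%N ->
  exists f : pinj L n, forall x y, f x = Some y <-> x = x0 /\ y = x0.
Proof.
move=> n0; pose f x := if pselect (x = x0) then Some x0 else None.
have fP x y : f x = Some y <-> x = x0 /\ y = x0.
  rewrite /f; case: pselect => [xx0|nx]; last by split=> // -[].
  by split=> [[<-]|[_ ->]].
have f_inj x1 x2 y : f x1 = Some y -> f x2 = Some y -> x1 = x2.
  by move=> /fP[-> _] /fP[-> _].
have f_rank : prange f #<= `I_n.
  apply: (@card_le_trans _ _ _ ((fun=> x0) @` `I_n)); last exact: card_image_le.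
  by apply: subset_card_le => y [x /fP[_ ->]]; exists 0%N.
by exists (PInj f_inj f_rank).
Qed.

End PartialInjections.

(** * The quotient as a semigroup of matrices *)

Section Entries.
Context {S : semigroup0Type} {L : Type} {n : nat}.
Local Open Scope group_scope.
Local Open Scope quotient_scope.
Implicit Types (x y z : L) (s t : S) (q a b e f : spinj_quot L n S).

Let zero : S := szero.

Lemma szero_mul s : zero * s = zero.
Proof. exact: smul0r. Qed.

Lemma szero_mulr s : s * zero = zero.
Proof. exact: smulr0. Qed.

Lemma mul_neq0l {s t : S} : s * t <> zero -> s <> zero.
Proof. by move=> st s0; apply: st; rewrite s0 szero_mul. Qed.

Lemma mul_neq0r {s t : S} : s * t <> zero -> t <> zero.
Proof. by move=> st t0; apply: st; rewrite t0 szero_mulr. Qed.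

(** Undefined values are read as zero, so that the congruence becomes equality
    of all entries. *)
Definition rep_entry (r : spinj L n S) x y : S :=
  if pselect (exists s, value r x y s) is left h then sval (cid h) else zero.

Lemma rep_entryP {r x y s} : s <> zero -> rep_entry r x y = s <-> value r x y s.
Proof.
move=> s0; rewrite /rep_entry; case: pselect => [h|nh].
  by case: cid => t /= vt; split=> [<-//|]; exact: value_fun.
by split=> [/esym//|v]; case: nh; exists s.
Qed.

Lemma rep_entry_neq0 r x y : rep_entry r x y <> zero -> under r x = Some y.
Proof. by move=> r0; apply: value_under ((rep_entryP r0).1 erefl). Qed.

Definition entry q : L -> L -> S := rep_entry (repr q).

Lemma rep_entry_equiv (r r' : spinj L n S) :
  equiv0 r r' <-> forall x y, rep_entry r x y = rep_entry r' x y.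
Proof.
split=> [/equiv0P rr' x y|rr'].
  have [r0|r0] := pselect (rep_entry r x y = zero).
    have [r'0|r'0] := pselect (rep_entry r' x y = zero); first by rewrite r0.
    by apply/rep_entryP => //; apply/rr' => //; apply/rep_entryP.
  by apply/esym/rep_entryP => //; apply/rr' => //; apply/rep_entryP.
by apply/equiv0P => x y s s0; split=> /(rep_entryP s0) v;
  apply/rep_entryP => //; rewrite -v rr'.
Qed.

Lemma entry_pi (r : spinj L n S) x y :
  entry (\pi_(spinj_quot L n S) r) x y = rep_entry r x y.
Proof. by apply: (rep_entry_equiv _ _).1; apply/pi_eqP; rewrite reprK. Qed.

Lemma entry_ext a b : (forall x y, entry a x y = entry b x y) -> a = b.
Proof. by move=> /rep_entry_equiv/pi_eqP; rewrite !reprK. Qed.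

Lemma entry_row {a x y z} : entry a x y <> zero -> entry a x z <> zero -> y = z.
Proof. by move=> /rep_entry_neq0 + /rep_entry_neq0 => -> []. Qed.

Lemma entry_col {a x y z} : entry a x z <> zero -> entry a y z <> zero -> x = y.
Proof. by move=> /rep_entry_neq0 + /rep_entry_neq0; exact: pfun_inj. Qed.

Lemma entry_row_neq {a x y z} : entry a x y <> zero -> y <> z -> entry a x z = zero.
Proof. by move=> xy yz; apply: contrapT => /(entry_row xy). Qed.

Lemma row_cases a x :
  (exists y, entry a x y <> zero) \/ (forall y, entry a x y = zero).
Proof.
have [?|nz] := pselect (exists y, entry a x y <> zero); first by left.
by right=> y; apply: contrapT => ?; apply: nz; exists y.
Qed.

(** At most one term of the matrix product is nonzero: a nonzero entry of the
    product is a single product of entries. *)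
Lemma entry_mul_neq0 {a b x z s} : s <> zero ->
  entry (a * b) x z = s <-> exists y, entry a x y * entry b y z = s.
Proof.
move=> s0; have -> : a * b = \pi_(spinj_quot L n S) (repr a * repr b) by rewrite pi_mulg !reprK.
rewrite entry_pi.
split=> [/(rep_entryP s0)/value_mul[y [t [u [va vb e]]]]|[y e]].
  have tu0 : t * u <> zero by rewrite -e.
  exists y; rewrite e; congr (_ * _); apply/rep_entryP => //.
    exact: mul_neq0l tu0.
  exact: mul_neq0r tu0.
have tu0 : entry a x y * entry b y z <> zero by rewrite e.
apply/rep_entryP => //; apply/value_mul.
exists y, (entry a x y), (entry b y z).
by split=> //; apply/rep_entryP => //; [exact: mul_neq0l tu0|exact: mul_neq0r tu0].
Qed.

(** This covers every way of computing an entry of a product: a nonzero entry in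
    the row of [a] or in the column of [b] determines the index [y], and when
    the row of [a] is zero any [y] will do. *)
Lemma entry_mul_unique a b x y z :
    (forall w, entry a x w * entry b w z <> zero -> w = y) ->
  entry (a * b) x z = entry a x y * entry b y z.
Proof.
move=> y_uniq; have [xyz0|xyz] := pselect (entry a x y * entry b y z = zero).
  rewrite xyz0; apply: contrapT => ab0.
  have [w xwz] := (entry_mul_neq0 ab0).1 erefl.
  have wy : w = y by apply: y_uniq; rewrite xwz.
  by apply: ab0; rewrite -xwz wy.
by apply/(entry_mul_neq0 xyz); exists y.
Qed.

Lemma entry_mul_row {a b x y z} : entry a x y <> zero ->
  entry (a * b) x z = entry a x y * entry b y z.
Proof.
by move=> xy; apply: entry_mul_unique => w /mul_neq0l xw; exact: entry_row xw xy.
Qed.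

Lemma entry_mul_col {a b x y z} : entry b y z <> zero ->
  entry (a * b) x z = entry a x y * entry b y z.
Proof.
by move=> yz; apply: entry_mul_unique => w /mul_neq0r wz; exact: entry_col wz yz.
Qed.

Lemma entry_mul_row0 a b x z :
  (forall y, entry a x y = zero) -> entry (a * b) x z = zero.
Proof.
move=> a0; rewrite (@entry_mul_unique a b x x z) ?a0 ?szero_mul // => w.
by rewrite a0 szero_mul.
Qed.

(** * Equations between matrices, entry by entry *)

(** Around a nonzero entry [s] of [a] at [(x, y)], the entry of [a * b * a] at
    [(x, y)] is [s * t * s] with [t] at [(y, x)] in [b], because [s] is alone in
    its row and in its column.  Conversely the entrywise equations make [t]
    nonzero as soon as [s] is, so that it too is alone in its row, which
    computes the whole row [x] of [a * b * a]. *)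
Lemma sandwich_entry a b : a * b * a = a <->
  forall x y, entry a x y * entry b y x * entry a x y = entry a x y.
Proof.
split=> [aba x y|aba].
  have [->|xy] := pselect (entry a x y = zero); first exact: szero_mulr.
  by rewrite -[in RHS]aba (entry_mul_col xy) (entry_mul_row xy).
apply: entry_ext => x z; rewrite -mulgA.
have [[y xy]|x0] := row_cases a x; last by rewrite entry_mul_row0.
have yx : entry b y x <> zero by apply: contra_not xy => yx;
    rewrite -aba yx szero_mulr szero_mul.
rewrite (entry_mul_row xy) (entry_mul_row yx) mulgA.
have [<-//|yz] := pselect (y = z).
by rewrite (entry_row_neq xy yz) szero_mulr.
Qed.

(** If [s] is the nonzero entry of [e = e * e] at [(x, y)], then [s] is a product
    of nonzero entries of [e] at [(x, z)] and [(z, y)]; as [e] has only one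
    nonzero entry in row [x] and one in column [y], this forces [x = z = y]. *)
Lemma idempotent_entry e : idempotents e <->
  (forall x y, entry e x y <> zero -> x = y) /\
  (forall x, idempotents (entry e x x)).
Proof.
split=> [ee|[ediag eidem]].
  have ediag x y : entry e x y <> zero -> x = y.
    move=> xy; have [z xzy] := (entry_mul_neq0 (b := e) (a := e) xy).1
      (congr1 (fun q => entry q x y) ee).
    have xzy0 : entry e x z * entry e z y <> zero by rewrite xzy.
    by rewrite (entry_col xy (mul_neq0r xzy0)); exact: entry_row (mul_neq0l xzy0) xy.
  split=> // x; rewrite /idempotents /=.
  have [->|xx] := pselect (entry e x x = zero); first exact: szero_mul.
  by rewrite -(entry_mul_row xx) ee.
apply: entry_ext => x z.
have [[y xy]|x0] := row_cases e x; last by rewrite entry_mul_row0.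
have exy := ediag _ _ xy; subst y; rewrite (entry_mul_row xy).
have [<-|xz] := pselect (x = z); first exact: eidem.
by rewrite (entry_row_neq xy xz) szero_mulr.
Qed.

(** * Matrices with prescribed entries *)

Lemma rep_entry_exists (f : pinj L n) (w : L -> L -> S) :
  exists q, forall x y,
    (f x = Some y -> entry q x y = w x y) /\ (f x <> Some y -> entry q x y = zero).
Proof.
pose r := @SPInj L n S f (fun p => w (val p).1 (val p).2).
exists (\pi_(spinj_quot L n S) r) => x y; rewrite entry_pi.
have rE : rep_entry r x y <> zero -> f x = Some y by exact: rep_entry_neq0.
split=> [fxy|nfxy]; last by apply: contrapT => /rE.
have [s v] := @under_value _ _ _ r x y fxy.
have ws : w x y = s by case: v => p [ep <-] /=; rewrite ep.
rewrite ws; have [s0|s0] := pselect (s = zero); last exact/rep_entryP.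
apply: contrapT; rewrite s0 => r0.
have /(rep_entryP r0) v' := erefl (rep_entry r x y).
by apply: r0; rewrite (value_fun v' v).
Qed.

(** Applying [phi] to the entries of the transpose creates no new nonzero entry
    when [phi] fixes zero. *)
Lemma transpose_exists (phi : S -> S) a : phi zero = zero ->
  exists b, forall x y, entry b y x = phi (entry a x y).
Proof.
move=> phi0; have [g gP] := pinj_transpose (under (repr a)).
have [b bP] := rep_entry_exists g (fun y x => phi (entry a x y)).
exists b => x y; have [gyx|ngyx] := pselect (g y = Some x); first by case: (bP y x) => ->.
have [_ ->//] := bP y x.
have [->//|/rep_entry_neq0/gP//] := pselect (entry a x y = zero).
Qed.

Lemma corner_exists (x0 : L) s : (0 < n)%N ->
  exists q, entry q x0 x0 = s /\
    forall x y, entry q x y <> zero -> x = x0 /\ y = x0.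
Proof.
move=> n0; have [f fP] := pinj_single x0 n0.
have [q qP] := rep_entry_exists f (fun _ _ => s).
exists q; split; first by apply: (qP _ _).1; apply/fP.
by move=> x y xy; apply/fP; apply: contrapT => /(qP x y).2.
Qed.

End Entries.

(** * Transfer of the three properties *)

Section Transfer.
Context {S : semigroup0Type} {L : Type} {n : nat}.
Local Open Scope group_scope.
Variables (x0 : L) (n0 : (0 < n)%N).
Let zero : S := szero.

Definition corner s : spinj_quot L n S := sval (cid (corner_exists x0 s n0)).

Lemma corner00 s : entry (corner s) x0 x0 = s.
Proof. by rewrite /corner; case: cid => q []. Qed.

Lemma corner_neq0 s x y : entry (corner s) x y <> zero -> x = x0 /\ y = x0.
Proof. by rewrite /corner; case: cid => q /= [_]; apply. Qed.

Lemma corner_eq0 s x y : ~ (x = x0 /\ y = x0) -> entry (corner s) x y = zero.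
Proof. by move=> nxy; apply: contrapT => /corner_neq0. Qed.

Lemma corner_sandwich s t : s * t * s = s -> corner s * corner t * corner s = corner s.
Proof.
move=> sts; apply/sandwich_entry => x y.
have [[-> ->]|nxy] := pselect (x = x0 /\ y = x0); first by rewrite !corner00.
by rewrite corner_eq0 // szero_mulr.
Qed.

Lemma corner_idempotent s : idempotents s -> idempotents (corner s).
Proof.
move=> ss; apply/idempotent_entry; split=> [x y /corner_neq0[-> ->]//|x].
have [->|nx] := pselect (x = x0); first by rewrite corner00.
by rewrite corner_eq0 => [|[]//]; exact: szero_mul.
Qed.

Lemma regular_quot : regular_semigroup (spinj_quot L n S) <-> regular_semigroup S.
Proof.
split=> [regQ s|regS a].
  have [b /esym/sandwich_entry sbs] := regQ (corner s).
  by exists (entry b x0 x0); have := sbs x0 x0; rewrite corner00.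
(* zero is its own weak inverse, but the hypothesis may provide another one *)
pose phi s := if pselect (s = zero) is left _ then zero else sval (cid (regS s)).
have phiP s : s * phi s * s = s.
  rewrite /phi; case: pselect => [->|_]; first exact: szero_mulr.
  by case: cid => t /= /esym.
have [|b bP] := @transpose_exists S L n phi a; first by rewrite /phi; case: pselect.
by exists b; apply/esym/sandwich_entry => x y; rewrite bP.
Qed.

Lemma orthodox_quot : orthodox_semigroup (spinj_quot L n S) <-> orthodox_semigroup S.
Proof.
split=> -[/regular_quot reg idemM]; split=> // e f ie jf.
  have /idempotent_entry[_ /(_ x0)] :=
    idemM _ _ (corner_idempotent e ie) (corner_idempotent f jf).
  rewrite (entry_mul_unique _ _ _ x0) ?corner00 // => w /mul_neq0l.
  by move=> /corner_neq0[].
have /idempotent_entry[ediag eidem] := ie.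
have /idempotent_entry[fdiag fidem] := jf.
have efE x z : entry (e * f) x z = entry e x x * entry f x z.
  by apply: entry_mul_unique => w /mul_neq0l/ediag.
apply/idempotent_entry; split=> [x z|x]; rewrite efE; last exact: idemM.
by move=> /mul_neq0r/fdiag.
Qed.

Lemma inverse_quot : inverse_semigroup (spinj_quot L n S) <-> inverse_semigroup S.
Proof.
split=> [invQ s|invS a].
  have [b [[/sandwich_entry sbs /sandwich_entry bsb] b_uniq]] := invQ (corner s).
  exists (entry b x0 x0); split.
    by have := conj (sbs x0 x0) (bsb x0 x0); rewrite corner00.
  (* every inverse t of s has as matrix the unique inverse b of the matrix of s *)
  have corner_b t : s * t * s = s /\ t * s * t = t -> b = corner t.
    by move=> [sts tst]; apply: b_uniq; split; exact: corner_sandwich.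
  by move=> t /corner_b ->; rewrite corner00.
have [phi phiP] := choice invS.
have phi_uniq s t : s * t * s = s -> t * s * t = t -> phi s = t.
  by move=> sts tst; case: (phiP s) => _; apply.
have phi0 : phi zero = zero by apply: phi_uniq; rewrite !szero_mul.
have [b bP] := transpose_exists phi a phi0; exists b; split.
  split; apply/sandwich_entry => x y; rewrite bP.
    by have [[]] := phiP (entry a x y).
  by have [[]] := phiP (entry a y x).
move=> c [/sandwich_entry aca /sandwich_entry cac].
by apply: entry_ext => y x; rewrite bP; exact: phi_uniq.
Qed.

End Transfer.

Theorem corollary3p6 (S : semigroup0Type) (L : Type) (n : nat) :
  [set: L] !=set0 -> (0 < n)%N -> `I_n #<= [set: L] ->
  [/\ regular_semigroup (spinj_quot L n S) <-> regular_semigroup S,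
      orthodox_semigroup (spinj_quot L n S) <-> orthodox_semigroup S
    & inverse_semigroup (spinj_quot L n S) <-> inverse_semigroup S].
Proof.
move=> [x0 _] n0 _; split.
- exact: regular_quot x0 n0.
- exact: orthodox_quot x0 n0.
- exact: inverse_quot x0 n0.
Qed.
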